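(* Let $f:\mathbb{R}^n\to\mathbb{R}$ and $g:\mathbb{R}^m\to\mathbb{R}$ be continuously differentiable and convex, let $A\in\mathbb{R}^{m\times n}$ with $m\ge n$ have full column rank, let $r\ge3$ and $t_0>0$, and let $V(x)=f(x)+g(Ax)$. If $X^\star$ is a strict local minimizer of $V$, i.e., there exists an open set $\mathcal{O}\subseteq\mathbb{R}^n$ such that $X^\star\in\mathcal{O}$ and $V(X)>V(X^\star)$ for all $X\in\mathcal{O}\setminus\{X^\star\}$, then $Y^\star=(X^\star,0)$ is a stable critical point of the dynamical system on $\mathbb{R}^n\times\mathbb{R}^n$ $$\frac{d}{dt}\begin{pmatrix} Y_1 \\ Y_2 \end{pmatrix}=\begin{pmatrix} Y_2 \\ -\tfrac{r}{t}Y_2-(A^TA)^{-1}\nabla V(Y_1) \end{pmatrix},\qquad t\ge t_0,$$ which, with $Y_1=X$ and $Y_2=\dot X$, is equivalent to the A-ADMM flow $\ddot X+\frac{r}{t}\dot X+(A^TA)^{-1}\nabla V(X)=0$.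
   Context: For a dynamical system $\dot Y=F(Y,t)$, $Y(t_0)=Y_0$, with $Y(t)\in\mathbb{R}^p$, a point $Y^\star$ with $F(Y^\star,t)=0$ for all $t\ge t_0$ is called a critical point. A critical point $Y^\star$ is stable if for every neighborhood $\mathcal{N}\subseteq\mathbb{R}^p$ of $Y^\star$ there is a neighborhood $\bar{\mathcal{N}}\subseteq\mathcal{N}$ of $Y^\star$ such that every solution $Y(t)$ with initial condition $Y(t_0)=Y_0\in\bar{\mathcal{N}}$ is defined (i.e. its maximal forward extension is defined) and remains in $\mathcal{N}$ for all $t>t_0$. *)

(* Defs.v *)
From mathcomp Require Import all_boot all_order all_algebra.
From mathcomp Require Import all_classical all_reals all_analysis.

Set Implicit Arguments.
Unset Strict Implicit.
Unset Printing Implicit Defensive.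
Import Order.TTheory GRing.Theory Num.Theory.
Import numFieldNormedType.Exports.

Local Open Scope classical_set_scope.
Local Open Scope ring_scope.

Definition gradient (R : realType) (n : nat) (f : 'cV[R]_n -> R)
    (x : 'cV[R]_n) : 'cV[R]_n :=
  \col_i 'D_(delta_mx i 0) f x.

Definition continuously_differentiable (R : realType) (n : nat)
    (f : 'cV[R]_n -> R) : Prop :=
  (forall x, differentiable f x) /\ continuous (gradient f).

Definition strict_local_minimizer (R : realType) (E : normedModType R)
    (V : E -> R) (xs : E) : Prop :=
  exists O : set E,
    [/\ open O, O xs & forall x, O x -> x != xs -> V xs < V x].

(* Derivative relative to the domain D: one-sided at an endpoint of D. *)
Definition has_derivative_within (R : realType) (E : normedModType R)
    (D : set R) (Y : R -> E) (t : R) (dY : E) : Prop :=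
  (s - t)^-1 *: (Y s - Y t) @[s --> within D t^'] --> dY.

Definition time_interval (R : realType) (t0 : R) (T : \bar R) : set R :=
  [set t | (t0%:E <= t%:E < T)%E].

(* Y solves Y' = F(Y, t) forward in time on [t0, T), where T may be +oo;
   the values of Y outside [t0, T) are irrelevant. *)
Definition is_solution (R : realType) (E : normedModType R)
    (F : E -> R -> E) (t0 : R) (T : \bar R) (Y : R -> E) : Prop :=
  (t0%:E < T)%E /\
  forall t, time_interval t0 T t ->
    has_derivative_within (time_interval t0 T) Y t (F (Y t) t).

(* F is not assumed Lipschitz, so a solution may have several maximal forward
   extensions. *)
Definition is_maximal_solution (R : realType) (E : normedModType R)
    (F : E -> R -> E) (t0 : R) (T : \bar R) (Y : R -> E) : Prop :=
  is_solution F t0 T Y /\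
  forall (T' : \bar R) (Y' : R -> E), (T <= T')%E -> is_solution F t0 T' Y' ->
    (forall t, time_interval t0 T t -> Y' t = Y t) -> T' = T.

Definition critical_point (R : realType) (E : normedModType R)
    (F : E -> R -> E) (t0 : R) (Ys : E) : Prop :=
  forall t, t0 <= t -> F Ys t = 0.

(* By Zorn's lemma every solution extends to a maximal one, so it is enough to
   constrain the maximal solutions. *)
Definition stable_critical_point (R : realType) (E : normedModType R)
    (F : E -> R -> E) (t0 : R) (Ys : E) : Prop :=
  critical_point F t0 Ys /\
  forall N : set E, nbhs Ys N ->
    exists Nbar : set E, [/\ nbhs Ys Nbar, Nbar `<=` N &
      forall (T : \bar R) (Y : R -> E),
        is_maximal_solution F t0 T Y -> Nbar (Y t0) ->
        T = +oo%E /\ forall t, t0 < t -> N (Y t)].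

Definition composite_objective (R : realType) (m n : nat) (f : 'cV[R]_n -> R)
    (g : 'cV[R]_m -> R) (A : 'M[R]_(m, n)) (x : 'cV[R]_n) : R :=
  f x + g (A *m x).

Definition aadmm_field (R : realType) (m n : nat) (A : 'M[R]_(m, n)) (r : R)
    (V : 'cV[R]_n -> R) (Y : 'cV[R]_n * 'cV[R]_n) (t : R) :
    'cV[R]_n * 'cV[R]_n :=
  (Y.2, - (r / t) *: Y.2 - invmx (A^T *m A) *m gradient V Y.1).

Definition aadmm_flow_solution (R : realType) (m n : nat) (A : 'M[R]_(m, n))
    (r : R) (V : 'cV[R]_n -> R) (t0 : R) (T : \bar R)
    (X : R -> 'cV[R]_n) : Prop :=
  (t0%:E < T)%E /\
  exists dX ddX : R -> 'cV[R]_n, forall t, time_interval t0 T t ->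
    [/\ has_derivative_within (time_interval t0 T) X t (dX t),
        has_derivative_within (time_interval t0 T) dX t (ddX t) &
        ddX t + (r / t) *: dX t + invmx (A^T *m A) *m gradient V (X t) = 0].

(* Main.v *)
Require Import Defs.
From HB Require Import structures.
From mathcomp Require Import all_boot all_order all_algebra.
From mathcomp Require Import all_classical all_reals all_analysis.
From mathcomp Require Import ring lra.

(* The energy H(x, y) = |A y|^2 / 2 + V x satisfies
   dH/dt = - (r / t) |A Y2|^2 <= 0 along the flow, and (Xs, 0) is a strict local
   minimizer of H because A is injective. On a small sphere around (Xs, 0), H is
   bounded below by some c > H(Xs, 0), so a solution that starts inside the
   sphere with H < c never crosses it. That a maximal solution confined to a
   compact set is global needs an extension past any finite time T: the
   solution is Lipschitz, hence has a limit at T, and Peano's theorem continues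
   it. The right-hand side is only continuous, so Picard-Lindelof is not
   available. *)

Set Implicit Arguments.
Unset Strict Implicit.
Unset Printing Implicit Defensive.
Import Order.TTheory GRing.Theory Num.Theory.
Import numFieldNormedType.Exports.

Local Open Scope classical_set_scope.
Local Open Scope ring_scope.

(** * One-sided derivatives *)

(** Without the division the estimate also holds at [s = t], so the puncture in [t^'] disappears.
    This is the form that passes to limits and survives gluing. *)
Lemma has_derivative_withinP (R : realType) (E : normedModType R) (D : set R)
    (Y : R -> E) (t : R) (d : E) :
  has_derivative_within D Y t d <->
  forall e, 0 < e -> exists2 del, 0 < del & forall s, D s -> `|s - t| < del ->
    `|Y s - Y t - (s - t) *: d| <= e * `|s - t|.
Proof.
have key s : s != t ->
    `|d - (s - t)^-1 *: (Y s - Y t)| * `|s - t| = `|Y s - Y t - (s - t) *: d|.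
  rewrite -subr_eq0 => st; rewrite mulrC -normrZ scalerBr scalerA mulfV//.
  by rewrite scale1r distrC.
rewrite /has_derivative_within; split=> [/cvgrPdist_le H e e0|H].
  have /nbhs_ballP[del /= del0 Hd] := H e e0.
  exists del => // s Ds st; have [->|sNt] := eqVneq s t.
    by rewrite !subrr scale0r subrr !normr0 mulr0.
  rewrite -key// ler_wpM2r//; apply: Hd => //.
  by rewrite /ball/= distrC.
apply/cvgrPdist_le => e e0; have [del del0 Hd] := H e e0.
apply/nbhs_ballP; exists del => //= s; rewrite /ball/= distrC => st sNt Ds.
rewrite -(ler_pM2r (_ : 0 < `|s - t|)) ?normr_gt0 ?subr_eq0// key//.
exact: Hd.
Qed.

Lemma has_derivative_within_continuous (R : realType) (E : normedModType R)
    (D : set R) (Y : R -> E) (t : R) (d : E) :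
  has_derivative_within D Y t d -> Y s @[s --> within D (nbhs t)] --> Y t.
Proof.
move=> /has_derivative_withinP H; apply/cvgrPdist_le => e e0.
have [del del0 Hd] := H 1 ltr01.
have c0 : 0 < 1 + `|d| by rewrite ltr_pwDl.
apply/nbhs_ballP; exists (Num.min del (e / (1 + `|d|))).
  by rewrite /= lt_min del0 divr_gt0.
move=> s; rewrite /ball/= distrC lt_min => /andP[st1 st2] Ds.
rewrite distrC -[Y s - _](subrK ((s - t) *: d)).
apply: (le_trans (ler_normD _ _)); apply: (le_trans (lerD (Hd _ Ds st1) (lexx _))).
by rewrite normrZ [_ * `|d|]mulrC -mulrDl mulrC -ler_pdivlMr// ltW.
Qed.

(** [Y] is vector-valued, so Rolle's theorem does not apply. Instead, with slope [M + e], the set of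
    times up to which the bound holds contains its supremum, and it extends past any supremum below
    [b]. *)
Lemma has_derivative_within_mean_value (R : realType) (E : normedModType R)
    (D : set R) (Y dY : R -> E) (a b M : R) :
  a <= b -> `[a, b] `<=` D ->
  (forall t, a <= t <= b -> has_derivative_within D Y t (dY t)) ->
  (forall t, a <= t <= b -> `|dY t| <= M) ->
  `|Y b - Y a| <= M * (b - a).
Proof.
move=> ab abD HY HM.
suff H e : 0 < e -> `|Y b - Y a| <= (M + e) * (b - a).
  apply/ler_addgt0Pr => e e0.
  (* The summand 1 keeps the denominator positive when [a = b]. *)
  have c0 : 0 < (b - a + 1) by rewrite ltr_wpDl// subr_ge0.
  apply: (le_trans (H _ (divr_gt0 e0 c0))).
  rewrite mulrDl lerD2l -mulrA ger_pMr// mulrC ler_pdivrMr// mul1r.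
  by rewrite lerDl.
move=> e0; pose S := [set s | a <= s <= b /\ `|Y s - Y a| <= (M + e) * (s - a)].
have Sa : S a by split; rewrite ?lexx// !subrr normr0 mulr0.
have hS : has_sup S.
  by split; [exists a|exists b => s [/andP[]]].
pose c := sup S.
have cab : a <= c <= b.
  apply/andP; split; first by apply: ub_le_sup => //; case: hS.
  by apply: ge_sup; [exists a|move=> s [/andP[]]].
have [del del0 Hd] := (has_derivative_withinP _ _ _ _).1 (HY c cab) e e0.
have loc s : a <= s <= b -> `|s - c| < del ->
    `|Y s - Y c| <= (M + e) * `|s - c|.
  move=> sab sc; rewrite -[Y s - _](subrK ((s - c) *: dY c)).
  apply: (le_trans (ler_normD _ _)).
  have Ds : D s by apply: abD; rewrite /= in_itv.
  apply: (le_trans (lerD (Hd _ Ds sc) (lexx _))).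
  by rewrite normrZ mulrC -mulrDr mulrC addrC ler_wpM2r// lerD2r HM.
(* A point of [S] within [del] below [c] carries the bound from [a]; [loc] carries it on to [c]. *)
have Sc : S c.
  split=> //; have [s Ss cs] := sup_adherent del0 hS.
  have sc : s <= c by apply: ub_le_sup => //; case: hS.
  case: (Ss) => sab Hs.
  have H1 : `|Y s - Y c| <= (M + e) * (c - s).
    have := loc s sab; rewrite ler0_norm ?subr_le0// opprB; apply.
    by rewrite ltrBlDl -ltrBlDr.
  rewrite -(subrK (Y s) (Y c)) -addrA; apply: (le_trans (ler_normD _ _)).
  rewrite distrC; apply: (le_trans (lerD H1 Hs)).
  by rewrite -mulrDr addrA subrK.
have [cb|bc] := ltP c b; last first.
  have <- : c = b by apply/eqP; rewrite eq_le bc andbT; case/andP: cab.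
  by case: Sc.
(* If [c < b], this point lies beyond [c] and still belongs to [S], contradicting the supremum. *)
pose s := Num.min b (c + del / 2).
have cs : c < s by rewrite lt_min cb ltrDl divr_gt0.
have sb : s <= b by rewrite ge_min lexx.
have ac : a <= c by case/andP: cab.
suff : S s by move/(ub_le_sup (proj2 hS)); rewrite leNgt cs.
split; first by rewrite sb (le_trans ac (ltW cs)).
rewrite -(subrK (Y c) (Y s)) -addrA; apply: (le_trans (ler_normD _ _)).
have sc : `|s - c| < del.
  rewrite gtr0_norm ?subr_gt0//.
  have : s <= c + del / 2 by rewrite ge_min lexx orbT.
  lra.
have := loc s; rewrite sb (le_trans ac (ltW cs)) => /(_ isT sc).
rewrite gtr0_norm ?subr_gt0// => H1.
case: Sc => _ H2; apply: (le_trans (lerD H1 H2)).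
by rewrite -mulrDr addrA subrK.
Qed.

(** * Peano's existence theorem *)

Section Euler.
Variables (R : realType) (E : normedModType R) (F : E -> R -> E).
Variables (a eta : R) (y : E).

Fixpoint euler_polygon (i : nat) : E :=
  if i is j.+1 then
    euler_polygon j + eta *: F (euler_polygon j) (a + j%:R * eta)
  else y.

(** An increment is [eta] times a sum of slopes, so closeness of every slope to [d] adds up. Taking
    [d = 0] gives a Lipschitz bound, and taking [d] to be a value of [F] gives the derivative of the
    limit. The nodes [i] and [j] come in either order because that derivative is tested on both
    sides. *)
Lemma euler_polygon_increment (d : E) (e : R) (i j : nat) : 0 <= eta ->
  (forall l, (minn i j <= l < maxn i j)%N ->
     `|F (euler_polygon l) (a + l%:R * eta) - d| <= e) ->
  `|euler_polygon j - euler_polygon i - ((j%:R - i%:R) * eta) *: d| <=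
    e * (`|j%:R - i%:R| * eta).
Proof.
move=> eta0; wlog ij : i j / (i <= j)%N => [H|].
  case/orP: (leq_total i j) => [ij|ji] Hl; first exact: H.
  rewrite -[X in `|X| <= _]opprK normrN (_ : - (_ - _) =
      euler_polygon i - euler_polygon j - ((i%:R - j%:R) * eta) *: d); last first.
    by rewrite opprD opprB opprK -scaleNr -mulNr opprB.
  by rewrite (distrC j%:R); apply: H => // l; rewrite minnC maxnC; exact: Hl.
rewrite (minn_idPl ij) (maxn_idPr ij) ger0_norm ?subr_ge0 ?ler_nat//.
elim: j ij => [|j IH].
  by rewrite leqn0 => /eqP -> _; rewrite !subrr !mul0r scale0r subrr normr0 mulr0.
rewrite leq_eqVlt => /predU1P[<- _|].
  by rewrite !subrr !mul0r scale0r subrr normr0 mulr0.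
rewrite ltnS => ij Hl /=.
have {}IH := IH ij.
have IH1 : `|euler_polygon j - euler_polygon i - ((j%:R - i%:R) * eta) *: d| <=
    e * ((j%:R - i%:R) * eta).
  by apply: IH => l /andP[il lj]; apply: Hl; rewrite il ltnW.
have H2 : `|F (euler_polygon j) (a + j%:R * eta) - d| <= e.
  by apply: Hl; rewrite ij ltnS leqnn.
set z := euler_polygon j in IH1 H2 *; set G := F z _ in H2 *.
have -> : z + eta *: G - euler_polygon i - ((j.+1%:R - i%:R) * eta) *: d
  = (z - euler_polygon i - ((j%:R - i%:R) * eta) *: d) + eta *: (G - d).
  have -> : (j.+1%:R - i%:R) * eta = (j%:R - i%:R) * eta + eta.
    by rewrite -natr1; ring.
  rewrite scalerDl scalerBr opprD !addrA; congr (_ - _).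
  by rewrite (addrAC z) (addrAC _ (eta *: G)).
apply: (le_trans (ler_normD _ _)); rewrite normrZ ger0_norm//.
apply: (le_trans (lerD IH1 (ler_wpM2l eta0 H2))).
rewrite -natr1; lra.
Qed.
End Euler.
(** Transports an ultrafilter on step counts to [E], where compactness makes it converge. *)
Lemma ultra_fmap (T U : Type) (f : T -> U) (F : set_system T) :
  UltraFilter F -> UltraFilter (f @ F).
Proof.
move=> FU; split; first exact: fmap_proper_filter.
move=> G GF FG; rewrite predeqE => A; split; last exact: FG.
move=> GA; have [//|] := in_ultra_setVsetC (f @^-1` A) FU.
rewrite preimage_setC => /(FG (~` A))/(filterI GA).
by rewrite setICr => /filter_not_empty.
Qed.

(* The Euler polygons P k with h / k.+1 as step are evaluated as step functions
   of t and converge pointwise along an ultrafilter U on nat. The increment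
   estimate passes to the limit and gives the derivative directly, with neither
   integrals nor uniform convergence. *)
Lemma peano_existence (R : realType) (E : normedModType R) (F : E -> R -> E)
    (a : R) (y : E) :
  (forall (z : E) (r : R), compact [set u : E | `|u - z| <= r]) ->
  (forall z t, a <= t -> {for (z, t), continuous (fun p : E * R => F p.1 p.2)}) ->
  exists (h : R) (Z : R -> E),
    [/\ 0 < h, Z a = y & is_solution F a (a + h)%:E Z].
Proof.
move=> cptE cF.
have cFe z t e : a <= t -> 0 < e -> exists2 rho, 0 < rho &
    forall z' t', `|z' - z| < rho -> `|t' - t| < rho -> `|F z' t' - F z t| <= e.
  move=> at0 e0; have /cvgrPdist_le/(_ e e0)/nbhs_ballP[rho /= rho0 Hrho] := cF z t at0.
  exists rho => // z' t' zz tt; have := Hrho (z', t'); rewrite /ball /= /prod_ball /=.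
  rewrite distrC; apply; split.
    by rewrite -ball_normE /= distrC.
  by rewrite /ball /= distrC.
have [rho rho0 Hrho] := cFe y a 1 (lexx _) ltr01.
(* [M] bounds the norm of [F] as long as the state is within [b] of [y] and the time within [b]
   after [a]. A polygon of speed at most [M] stays in that ball up to time [h = b / M]. The 1 is the
   tolerance in [Hrho]; it also gives [1 <= M], hence [h <= b]. *)
pose M := `|F y a| + 1; pose b := rho / 2.
have M1 : 1 <= M by rewrite lerDr.
have M0 : 0 < M by apply: lt_le_trans M1.
have b0 : 0 < b by rewrite divr_gt0.
have FM z s : `|z - y| <= b -> a <= s <= a + b -> `|F z s| <= M.
  move=> zb sb; rewrite -(subrK (F y a) (F z s)).
  apply: (le_trans (ler_normD _ _)); rewrite addrC lerD2l.
  have brho : b < rho by rewrite /b; lra.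
  apply: Hrho; first exact: le_lt_trans brho.
  rewrite ger0_norm; lra.
pose h := b / M; have h0 : 0 < h by rewrite divr_gt0.
have hb : h <= b by rewrite ler_pdivrMr// ler_peMr// ltW.
have Mh : M * h = b by rewrite mulrC divfK// gt_eqF.
pose eta (k : nat) := h / k.+1%:R.
have eta0 k : 0 < eta k by rewrite divr_gt0.
have etah k i : (i <= k.+1)%N -> i%:R * eta k <= h.
  by move=> ik; rewrite mulrCA ger_pMr// ler_pdivrMr// mul1r ler_nat.
pose P k := euler_polygon F a (eta k) y.
(* Strong induction: the slope bound on each earlier step requires the earlier vertices to lie in
   the ball already. *)
have Pb k i : (i <= k.+1)%N -> `|P k i - y| <= b.
  elim/ltn_ind: i => i IH ik.
  have := @euler_polygon_increment _ _ F a (eta k) y 0 M 0 i (ltW (eta0 k)).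
  rewrite min0n max0n => H.
  rewrite scaler0 !subr0 in H; apply: (le_trans (H _)) => [l /= li|].
    rewrite subr0; apply: FM.
      by apply: IH => //; apply: leq_trans ik; apply: ltnW.
    rewrite lerDl mulr_ge0 ?(ltW (eta0 _))//= lerD2l (le_trans _ hb)//.
    by apply: etah; apply: leq_trans ik; apply: ltnW.
  by rewrite ger0_norm// -Mh ler_pM2l// etah.
have lip k i j : (i <= k.+1)%N -> (j <= k.+1)%N ->
    `|P k j - P k i| <= M * (`|j%:R - i%:R| * eta k).
  move=> ik jk.
  have := @euler_polygon_increment _ _ F a (eta k) y 0 M i j (ltW (eta0 k)).
  rewrite scaler0 subr0; apply => l /andP[_ lj].
  have lk : (l <= k.+1)%N.
    by apply/ltnW/(leq_trans lj); rewrite geq_max ik jk.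
  rewrite subr0; apply: FM; first exact: Pb.
  by rewrite lerDl mulr_ge0 ?(ltW (eta0 _))//= lerD2l (le_trans _ hb)// etah.
pose D := time_interval a (a + h)%:E.
have DE t : D t -> a <= t < a + h by rewrite /D/time_interval/= !lee_fin !lte_fin.
(* [idx k t] is the last node not after [t], and [tau k t] is its time measured from [a], short of
   [t - a] by less than one step. *)
pose idx k t := Num.truncn ((t - a) / eta k).
pose tau k t : R := (idx k t)%:R * eta k.
have tau_le k t : D t -> tau k t <= t - a < tau k t + eta k.
  move=> /DE /andP[at0 th].
  have : 0 <= (t - a) / eta k by rewrite divr_ge0 ?subr_ge0// ltW.
  move=> /truncn_itv; rewrite ler_pdivlMr// ltr_pdivrMr//.
  by rewrite -natr1 -/(idx k t) -/(tau k t) => /andP[-> H2]; rewrite /tau; lra.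
have idxk k t : D t -> (idx k t <= k.+1)%N.
  move=> Dt; rewrite -(ler_nat R) -(ler_pM2r (eta0 k)).
  have /andP[H _] := tau_le k t Dt; apply: (le_trans H).
  rewrite /eta mulrC divfK//; move/DE : Dt; lra.
have [U [UU subU]] := ultraFilterLemma (@eventually_filter).
have PU : ProperFilter U by case: UU.
have etaU : eta k @[k --> U] --> 0.
  apply: (cvg_trans (G := eta k @[k --> \oo])); first exact: cvg_app subU.
  have -> : 0 = h * 0 :> R by rewrite mulr0.
  exact: cvgMl_tmp cvg_harmonic.
have tauU t : D t -> tau k t @[k --> U] --> t - a.
  move=> Dt; apply/cvgrPdist_le => e e0.
  have /cvgrPdist_le/(_ e e0) := etaU.
  apply: filterS => k; rewrite sub0r normrN (ger0_norm (ltW (eta0 k))).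
  have /andP[t1 t2] := tau_le k t Dt.
  move=> t3; rewrite ger0_norm ?subr_ge0//; apply: le_trans t3; lra.
(* The image ultrafilter contains a compact ball, so it converges. Outside [D] the value 0 is a mere
   default. *)
have exZ t : exists z : E, D t -> P k (idx k t) @[k --> U] --> z.
  have [Dt|nDt] := pselect (D t); last by exists 0.
  have := cptE y b; rewrite compact_ultra => /(_ (P k (idx k t) @[k --> U])).
  case => [||z [_ Hz]]; [| |by exists z].
    exact: ultra_fmap.
  by apply: (@filterE _ U) => k; apply: Pb; exact: idxk.
have [Z HZ] := choice exZ.
have Da : D a.
  by rewrite /D /time_interval /= !lee_fin lexx /= lte_fin ltrDl.
exists h, Z; split => //.
  apply: (norm_cvg_unique (F := P k (idx k a) @[k --> U])); first exact: HZ.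
  have -> : (fun k => P k (idx k a)) = cst y.
    by apply/funext => k; rewrite /idx subrr mul0r truncn0.
  exact: cvg_cst.
split; first by rewrite lte_fin ltrDl.
move=> t Dt; apply/has_derivative_withinP => e e0.
have at0 : a <= t by case/DE/andP : (Dt).
have [r r0 Hr] := cFe (Z t) t e at0 e0.
(* Any node between those of [s] and [t] is less than [2 * (r / (4 * M))] in time from the node of
   [t]: one share for [s - t], one for the step [eta k]. At speed [M] the polygon moves less than
   [r / 2], and the remaining [r / 2] is the distance from its vertex to [Z t]. *)
have r4 : 0 < r / (4 * M) by rewrite divr_gt0// mulr_gt0.
exists (r / (4 * M)) => // s Ds st.
set d := F (Z t) t.
have cvgtau : tau k s - tau k t @[k --> U] --> s - t.
  have -> : s - t = (s - a) - (t - a) by ring.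
  by apply: cvgB; exact: tauU.
suff : \forall k \near U,
    `|P k (idx k s) - P k (idx k t) - (tau k s - tau k t) *: d| <=
    e * `|tau k s - tau k t|.
  apply: ler_cvg_to.
    apply: cvg_norm; apply: cvgB; first by apply: cvgB; apply: HZ.
    exact: cvgZr_tmp.
  by apply: cvgMl_tmp; exact: cvg_norm.
near=> k.
have etak : eta k < r / (4 * M).
  near: k; exact: (cvgr_lt 0).
have Pt : `|P k (idx k t) - Z t| < r / 2.
  near: k; apply: cvgr_distC_lt; [exact: HZ|by rewrite divr_gt0].
have taukE : tau k s - tau k t = ((idx k s)%:R - (idx k t)%:R) * eta k.
  by rewrite mulrBl.
have -> : `|tau k s - tau k t| = `|(idx k s)%:R - (idx k t)%:R| * eta k.
  by rewrite taukE normrM (ger0_norm (ltW (eta0 k))).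
rewrite taukE; apply: euler_polygon_increment; first exact: ltW.
move=> l /andP[ml lm].
have Ml : M * (r / (4 * M)) = r / 4.
  by rewrite invfM (mulrCA M) (mulrCA M) mulfV ?mulr1 ?gt_eqF.
have rM : r / (4 * M) <= r / 4.
  by rewrite -Ml ler_peMl// ltW.
have lt : `|l%:R * eta k - tau k t| < r / (4 * M) + r / (4 * M) /\
    `|l%:R * eta k - (t - a)| < r / (4 * M) + r / (4 * M).
  have /andP[s1 s2] := tau_le k s Ds; have /andP[t1 t2] := tau_le k t Dt.
  move: st; rewrite ltr_norml => /andP[st1 st2].
  have le_tau i j : (i <= j)%N -> i%:R * eta k <= j%:R * eta k.
    by move=> ij; rewrite ler_pM2r// ler_nat.
  case/orP: (leq_total (idx k t) (idx k s)) => ts; move: ml lm.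
    rewrite (minn_idPl ts) (maxn_idPr ts) => /le_tau l1 /ltnW/le_tau l2.
    split; rewrite ltr_norml; apply/andP; split; move: l1 l2;
      rewrite -!/(tau k _); lra.
  rewrite (minn_idPr ts) (maxn_idPl ts) => /le_tau l1 /ltnW/le_tau l2.
  split; rewrite ltr_norml; apply/andP; split; move: l1 l2;
    rewrite -!/(tau k _); lra.
have lk : (l <= k.+1)%N.
  by apply/ltnW/(leq_trans lm); rewrite geq_max !idxk.
apply: Hr; last first.
  rewrite (_ : a + _ - t = l%:R * eta k - (t - a)); last by ring.
  by apply: (lt_le_trans (proj2 lt)); lra.
rewrite -(subrK (P k (idx k t)) (euler_polygon _ _ _ _ _)) -addrA.
apply: (le_lt_trans (ler_normD _ _)).
have := lip k (idx k t) l (idxk _ _ Dt) lk; rewrite -/(P k l).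
have -> : `|l%:R - (idx k t)%:R| * eta k = `|l%:R * eta k - tau k t|.
  by rewrite /tau -mulrBl normrM (ger0_norm (ltW (eta0 k))).
move=> H; have : M * `|l%:R * eta k - tau k t| < r / 4 + r / 4.
  by rewrite -Ml -mulrDr ltr_pM2l//; case: lt.
lra.
Unshelve. all: end_near.
Qed.
(** * Continuation of solutions *)

(** Only the time [T], approached from the left, is delicate. There [F (Y u) u] tends to [F y T] by
    continuity, and the mean value inequality for [Y u - u *: d], whose derivative is therefore
    small, yields the left derivative. *)
Lemma is_solution_glue (R : realType) (E : normedModType R) (F : E -> R -> E)
    (t0 T h : R) (y : E) (Y Z : R -> E) :
  0 < h -> {for (y, T), continuous (fun p : E * R => F p.1 p.2)} ->
  is_solution F t0 T%:E Y -> Y s @[s --> T^'-] --> y ->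
  is_solution F T (T + h)%:E Z -> Z T = y ->
  is_solution F t0 (T + h)%:E (fun t => if t < T then Y t else Z t).
Proof.
move=> h0 cF [t0T solY] Yy [TTh solZ] ZT; rewrite lte_fin in t0T.
split; first by rewrite lte_fin ltr_wpDr// ltW.
move=> t; rewrite /time_interval /= lee_fin lte_fin => /andP[t0t tTh].
apply/has_derivative_withinP => e e0.
have inY s : t0 <= s -> s < T -> time_interval t0 T%:E s.
  by move=> ? ?; apply/andP; rewrite lee_fin lte_fin.
have inZ s : T <= s -> s < T + h -> time_interval T (T + h)%:E s.
  by move=> ? ?; apply/andP; rewrite lee_fin lte_fin.
have [tT|Tt] := ltP t T.
  have [del del0 Hd] := (has_derivative_withinP _ _ _ _).1 (solY t (inY t t0t tT)) e e0.
  exists (Num.min del (T - t)); first by rewrite lt_min del0 subr_gt0.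
  move=> s /andP[]; rewrite lee_fin lte_fin => t0s sTh.
  rewrite lt_min => /andP[s1 s2].
  have sT : s < T by move: s2; rewrite ltr_norml; lra.
  by rewrite sT; apply: Hd => //; exact: inY.
have [del del0 Hd] := (has_derivative_withinP _ _ _ _).1 (solZ t (inZ t Tt tTh)) e e0.
have [Tt'|tT] := ltP T t.
  exists (Num.min del (t - T)); first by rewrite lt_min del0 subr_gt0.
  move=> s /andP[]; rewrite lee_fin lte_fin => t0s sTh.
  rewrite lt_min => /andP[s1 s2].
  have Ts : T <= s by move: s2; rewrite ltr_norml; lra.
  by rewrite ltNge Ts /=; apply: Hd => //; exact: inZ.
have {Tt}tT : t = T by apply/eqP; rewrite eq_le Tt tT.
subst t; set d := F (Z T) T in Hd *.
have idT : u @[u --> T^'-] --> T by apply: cvg_at_left_filter; exact: cvg_id.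
have FY : F (Y u) u @[u --> T^'-] --> F y T.
  apply: (cvg_comp (fun u => (Y u, u)) (fun p => F p.1 p.2) _ cF).
  exact: (cvg_pair Yy idT).
have [eta /= eta0 Heta] : exists2 eta, 0 < eta & forall u, `|u - T| < eta ->
    u < T -> `|F (Y u) u - d| <= e.
  have /cvgrPdist_le/(_ e e0)/nbhs_ballP[eta eta0 H] := FY.
  exists eta => // u uT; rewrite distrC /d ZT; apply: H.
  by rewrite /ball/= distrC.
exists (Num.min del eta); first by rewrite lt_min del0 eta0.
move=> s /andP[]; rewrite lee_fin lte_fin => t0s sTh.
rewrite lt_min => /andP[s1 s2].
have [sT|Ts] := ltP s T; last by apply: Hd => //; exact: inZ.
rewrite (_ : `|Y s - Z T - _| = `|y - Y s - (T - s) *: d|); last first.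
  by rewrite -(normrN (y - _ - _)) opprD opprB opprK ZT -scaleNr opprB.
have Yd u v : Y v - v *: d - (Y u - u *: d) = Y v - Y u - (v - u) *: d.
  rewrite scalerBl !opprB !addrA addrAC [RHS]addrAC; congr (_ + _).
  by rewrite addrAC.
rewrite (distrC s) (gtr0_norm (_ : 0 < T - s)) ?subr_gt0//.
(* The value [Y T] is unconstrained, so the estimate is made on [[s, v]] with [v < T]; letting [v]
   tend to [T] then replaces [Y v] by [y]. *)
have : \forall v \near T^'-, `|Y v - Y s - (v - s) *: d| <= e * (v - s).
  near=> v.
  have sv : s < v by near: v; exact: nbhs_left_gt.
  have vT : v < T by near: v; exact: nbhs_left_lt.
  have := @has_derivative_within_mean_value _ _ (time_interval t0 T%:E)
    (fun u => Y u - u *: d) (fun u => F (Y u) u - d) s v e (ltW sv).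
  rewrite Yd.
  apply.
  - move=> u; rewrite /= in_itv /= => /andP[su uv].
    by apply: inY; [exact: le_trans su|exact: le_lt_trans vT].
  - move=> u /andP[su uv]; apply/has_derivative_withinP => e1 e10.
    have Du : time_interval t0 T%:E u.
      by apply: inY; [exact: le_trans su|exact: le_lt_trans vT].
    have [r r0 Hr] := (has_derivative_withinP _ _ _ _).1 (solY u Du) e1 e10.
    exists r => // w Dw wr; have := Hr w Dw wr; congr (`|_| <= _).
    by rewrite Yd scalerBr opprB addrA subrK.
  - move=> u /andP[su uv]; apply: Heta; last exact: le_lt_trans vT.
    rewrite ltr0_norm ?subr_lt0; last exact: le_lt_trans vT.
    by move: s2; rewrite ltr0_norm ?subr_lt0//; lra.
apply: ler_cvg_to.
- apply: cvg_norm; apply: cvgB; first by apply: cvgB => //; exact: cvg_cst.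
  apply: cvgZr_tmp; apply: cvgB; [exact: idT|exact: cvg_cst].
- apply: cvgMl_tmp; apply: cvgB; [exact: idT|exact: cvg_cst].
Unshelve. all: by end_near.
Qed.

(** Bounded speed makes [Y] Lipschitz on [[t0, T)]. Compactness supplies a cluster point at [T], and
    the Lipschitz bound turns it into a limit. *)
Lemma is_solution_left_limit (R : realType) (E : normedModType R)
    (F : E -> R -> E) (t0 T : R) (Y : R -> E) (K : set E) (M : R) :
  compact K -> is_solution F t0 T%:E Y ->
  (forall t, time_interval t0 T%:E t -> K (Y t) /\ `|F (Y t) t| <= M) ->
  exists2 y, K y & Y s @[s --> T^'-] --> y.
Proof.
move=> cK [t0T solY] HY; rewrite lte_fin in t0T.
have inY s : t0 <= s -> s < T -> time_interval t0 T%:E s.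
  by move=> ? ?; apply/andP; rewrite lee_fin lte_fin.
have M0 : 0 <= M.
  by have [_] := HY t0 (inY t0 (lexx _) t0T); apply: le_trans.
have lip s u : t0 <= s -> s <= u -> u < T -> `|Y u - Y s| <= M * (u - s).
  move=> t0s su uT.
  apply: (@has_derivative_within_mean_value _ _ (time_interval t0 T%:E) Y
    (fun u => F (Y u) u)) => //.
  - move=> v; rewrite /= in_itv /= => /andP[sv vu].
    by apply: inY; [exact: le_trans sv|exact: le_lt_trans uT].
  - move=> v /andP[sv vu]; apply: solY.
    by apply: inY; [exact: le_trans sv|exact: le_lt_trans uT].
  - move=> v /andP[sv vu]; apply: (proj2 (HY _ _)).
    by apply: inY; [exact: le_trans sv|exact: le_lt_trans uT].
have KY : \forall s \near T^'-, K (Y s).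
  near=> s; apply: (proj1 (HY _ _)); apply: inY.
    by near: s; apply: nbhs_left_ge.
  by near: s; exact: nbhs_left_lt.
have [y [Ky cly]] := cK (Y s @[s --> T^'-]) _ KY.
exists y => //; apply/cvgrPdist_le => e e0.
(* Within this distance of [T] the solution moves by at most [e / 2]; the other half is for the
   cluster point. Adding 1 to [M] covers [M = 0]. *)
have c0 : 0 < e / (2 * (M + 1)) by rewrite divr_gt0// mulr_gt0// ltr_wpDl.
near=> s.
have t0s : t0 < s by near: s; exact: nbhs_left_gt.
have sT : s < T by near: s; exact: nbhs_left_lt.
have Ms : M * (T - s) <= e / 2.
  have : T - s < e / (2 * (M + 1)).
    by rewrite ltrBlDr -ltrBlDl; near: s; apply: nbhs_left_gt; rewrite gtrBl.
  rewrite ltr_pdivlMr ?mulr_gt0// ?ltr_wpDl// => H.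
  have : 0 < T - s by rewrite subr_gt0.
  lra.
have sY : \forall u \near T^'-, [set Y v | v in `]s, T[] (Y u).
  near=> u; exists u => //=; rewrite in_itv /=; apply/andP; split.
    by near: u; exact: nbhs_left_gt.
  by near: u; exact: nbhs_left_lt.
have [] := cly [set Y u | u in `]s, T[] (ball y (e / 2)) sY.
  by apply: nbhsx_ballx; rewrite divr_gt0.
move=> _ [[u + <-]]; rewrite /= in_itv /= => /andP[su uT].
rewrite -ball_normE /= => yu.
rewrite -(subrK (Y u) y) -addrA (le_trans (ler_normD _ _))//.
have := lip s u (ltW t0s) (ltW su) uT.
have : M * (u - s) <= M * (T - s) by rewrite ler_wpM2l// lerD2r ltW.
lra.
Unshelve. all: by end_near.
Qed.

(** For finite [T], [F] is bounded on the compact set [K] times [[t0, T]], so [Y] has a left limit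
    at [T]. Restarting from it gives a solution up to [T + h] that agrees with [Y], against
    maximality. *)
Lemma compact_maximal_solution_global (R : realType) (E : normedModType R)
    (F : E -> R -> E) (t0 : R) (T : \bar R) (Y : R -> E) (K : set E) :
  (forall (z : E) (r : R), compact [set u : E | `|u - z| <= r]) ->
  (forall z t, t0 <= t -> {for (z, t), continuous (fun p : E * R => F p.1 p.2)}) ->
  compact K -> is_maximal_solution F t0 T Y ->
  (forall t, time_interval t0 T t -> K (Y t)) -> T = +oo%E.
Proof.
move=> cptE cF cK [solY maxY] YK.
case: T solY maxY YK => [T| |] solY maxY YK //; last by case: solY.
have t0T : t0 < T by case: solY; rewrite lte_fin.
have [[z s] /= _ zmax] : exists2 p : E * R, p \in K `*` `[t0, T] &
    forall q, q \in K `*` `[t0, T] -> `|F q.1 q.2| <= `|F p.1 p.2|.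
  apply: compact_EVT_max.
  - exists (Y t0, t0); split => /=; last by rewrite in_itv/= lexx ltW.
    by apply: YK; rewrite /time_interval/= lexx lte_fin.
  - by apply: compact_setX => //; exact: segment_compact.
  - apply: continuous_in_subspaceT => -[u v]; rewrite inE => -[_ /=].
    rewrite in_itv/= => /andP[t0v _]; apply: cvg_norm; exact: cF.
have HK t : time_interval t0 T%:E t -> K (Y t) /\ `|F (Y t) t| <= `|F z s|.
  move=> tT; split; first exact: YK.
  apply: (zmax (Y t, t)); rewrite inE; split; first exact: YK.
  by move: tT => /andP[]; rewrite lee_fin lte_fin /= in_itv /= => -> /ltW.
have [y Ky Yy] := is_solution_left_limit cK solY HK.
have [h [Z [h0 ZT solZ]]] := @peano_existence _ _ F T y cptE
  (fun z t Tt => cF z t (le_trans (ltW t0T) Tt)).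
have /= H := maxY _ _ _ (is_solution_glue h0 (cF y T (ltW t0T)) solY Yy solZ ZT).
have : (T + h)%:E = T%:E.
  apply: H; first by rewrite lee_fin lerDl ltW.
  by move=> t /andP[_]; rewrite lte_fin => ->.
move=> /eqP; rewrite eqe -subr_eq0 addrAC subrr add0r => /eqP h00.
by rewrite h00 ltxx in h0.
Qed.
(** * Lyapunov stability *)

(** At interior times the relative derivative is the ordinary one, which gives access to the chain
    rule and to monotonicity criteria. *)
Lemma has_derivative_within_is_derive (R : realType) (E : normedModType R)
    (D : set R) (Y : R -> E) (t : R) (d : E) :
  nbhs t D -> has_derivative_within D Y t d -> is_derive t 1 Y d.
Proof.
move=> /nbhs_ballP[r /= r0 rD] /has_derivative_withinP HY.
have H : h^-1 *: (Y (h *: 1 + t) - Y t) @[h --> 0^'] --> d.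
  apply/cvgrPdist_le => e e0; have [del del0 Hd] := HY e e0.
  apply/nbhs_ballP; exists (Num.min r del); first by rewrite /= lt_min r0 del0.
  move=> h; rewrite /ball/= sub0r normrN lt_min => /andP[hr hdel] hN0.
  have h0 : 0 < `|h| by rewrite normr_gt0.
  have ht : h *: 1 + t - t = h by rewrite addrK /GRing.scale /= mulr1.
  rewrite -(ler_pM2l h0) -normrZ scalerBr scalerA mulfV// scale1r distrC mulrC.
  have := Hd (h *: 1 + t); rewrite ht; apply => //.
  by apply: rD; rewrite /ball/= distrC ht.
split; first by apply/cvg_ex; exists d.
exact: cvg_lim.
Qed.

Lemma is_derive_diff_comp (R : realType) (E : normedModType R) (H : E -> R)
    (Y : R -> E) (t : R) (d : E) :
  differentiable H (Y t) -> is_derive t 1 Y d ->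
  is_derive t 1 (H \o Y) ('d H (Y t) d).
Proof.
move=> dH [/derivable1_diffP dY Yd].
have dHY : differentiable (H \o Y) t by exact: differentiable_comp.
split; first exact/derivable1_diffP.
have <- : 'd Y t 1 = d by rewrite -deriveE.
by rewrite deriveE// diff_comp.
Qed.

Section Lyapunov.
Variables (R : realType) (E : normedModType R) (F : E -> R -> E) (t0 : R).

(** By the chain rule the derivative of [H \o Y] is nonpositive on the open interval []t0, t[],
    where two-sided derivatives exist; at the endpoints continuity suffices. *)
Lemma lyapunov_nonincreasing (H : E -> R) (T : \bar R) (Y : R -> E) (t : R) :
  (forall z, differentiable H z) ->
  (forall z s, t0 <= s -> 'd H z (F z s) <= 0) ->
  is_solution F t0 T Y -> time_interval t0 T t -> H (Y t) <= H (Y t0).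
Proof.
move=> dH H0 [t0T solY] /andP[]; rewrite lee_fin => t0t tT.
have dHY s : s \in `]t0, t[ -> is_derive s 1 (H \o Y) ('d H (Y s) (F (Y s) s)).
  rewrite in_itv /= => /andP[t0s st]; apply: is_derive_diff_comp => //.
  have sT : time_interval t0 T s.
    by rewrite /time_interval /= lee_fin (ltW t0s) (lt_trans _ tT)// lte_fin.
  apply: (has_derivative_within_is_derive _ (solY s sT)).
  near=> u; rewrite /time_interval /= lee_fin; apply/andP; split.
    by apply: ltW; near: u; exact: lt_nbhsr.
  by apply: lt_trans tT; rewrite lte_fin; near: u; exact: lt_nbhsl.
apply: (@ler0_derive1_le_cc _ (H \o Y) t0 t) => //;
  try by rewrite in_itv /= lexx t0t.
- by move=> s /dHY[].
- move=> s /[dup] st /dHY[_]; rewrite derive1E => ->; apply: H0.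
  by move: st; rewrite in_itv /= => /andP[/ltW].
- apply/subspace_continuousP => s; rewrite /= in_itv /= => /andP[t0s st].
  have sT : time_interval t0 T s.
    by rewrite /time_interval /= lee_fin t0s (le_lt_trans _ tT)// lee_fin.
  apply: (cvg_comp Y H) (differentiable_continuous (dH (Y s))).
  apply: cvg_trans (has_derivative_within_continuous (solY s sT)).
  apply: cvg_app; apply: within_subset => u; rewrite /= in_itv /=.
  move=> /andP[t0u ut].
  by rewrite /time_interval /= lee_fin t0u (le_lt_trans _ tT)// lee_fin.
Unshelve. all: by end_near.
Qed.

Theorem lyapunov_stability (H : E -> R) (Ys : E) :
  (forall (z : E) (r : R), compact [set u : E | `|u - z| <= r]) ->
  (forall z t, t0 <= t -> {for (z, t), continuous (fun p : E * R => F p.1 p.2)}) ->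
  critical_point F t0 Ys -> strict_local_minimizer H Ys ->
  (forall z, differentiable H z) ->
  (forall z t, t0 <= t -> 'd H z (F z t) <= 0) ->
  stable_critical_point F t0 Ys.
Proof.
move=> cptE cF crit [U [oU UYs HU]] dH H0; split=> // N NYs.
have cH : continuous H by move=> z; exact/differentiable_continuous.
have /nbhs_closedballP[p] : nbhs Ys (N `&` U).
  by apply: filterI => //; exact: open_nbhs_nbhs (conj oU UYs).
rewrite closed_ballE//; set r := p%:num => rNO; have r0 : 0 < r by rewrite /r.
pose S := [set u : E | `|u - Ys| = r].
have cN : continuous (fun u : E => `|u - Ys|).
  by move=> u; apply: cvg_norm; apply: cvgB => //; exact: cvg_cst.
have cS : compact S.
  apply: (subclosed_compact _ (cptE Ys r)); last by move=> u /= ->.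
  apply: (preimage_closed (f := fun u : E => `|u - Ys|) (D := [set r])).
    by move=> *; exact: cN.
  exact: closed_eq.
(* The barrier level is the minimum of [H] on the compact sphere. In the zero space the sphere is
   empty and any level above [H Ys] will do. *)
have [c Hc cS'] : exists2 c, H Ys < c & forall u, S u -> c <= H u.
  have [S0|/set0P S0] := eqVneq S set0.
    by exists (H Ys + 1); [rewrite ltrDl|rewrite S0].
  have [u + Hu] := compact_EVT_min S0 cS (continuous_subspaceT cH).
  rewrite inE => Su; exists (H u); last by move=> v Sv; apply: Hu; rewrite inE.
  apply: HU.
    by apply: (proj2 (rNO _ _)); rewrite /closed_ball_/= distrC Su.
  by apply/eqP => uYs; move: Su r0; rewrite /S/= uYs subrr normr0 => <-; rewrite ltxx.
exists [set u | `|u - Ys| < r /\ H u < c]; split.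
- apply: filterI.
    apply: (cvgr_lt `|Ys - Ys|); first exact: cN.
    by rewrite subrr normr0.
  by apply: (cvgr_lt (H Ys)) => //; exact: cH.
- move=> u [/ltW ur _]; apply: (proj1 (rNO _ _)).
  by rewrite /closed_ball_/= distrC.
move=> T Y maxY [Yr YHc].
have solY : is_solution F t0 T Y by case: maxY.
(* To leave the ball, [Y] would cross the sphere by the intermediate value theorem; there [H] is at
   least [c], yet it started below [c] and never increases. *)
have stay t : time_interval t0 T t -> `|Y t - Ys| <= r.
  move=> tT; rewrite leNgt; apply/negP => rY.
  have t0t : t0 <= t by case/andP: tT; rewrite lee_fin.
  have sT s : t0 <= s -> s <= t -> time_interval t0 T s.
    move=> t0s st; case/andP: tT => _ tT.
    by rewrite /time_interval/= lee_fin t0s (le_lt_trans _ tT)// lee_fin.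
  have [||s] := @IVT _ (fun s => `|Y s - Ys|) t0 t r t0t.
  - apply/subspace_continuousP => s; rewrite /= in_itv /= => /andP[t0s st].
    apply: cvg_norm; apply: cvgB; last exact: cvg_cst.
    apply: cvg_trans (has_derivative_within_continuous (proj2 solY s (sT s t0s st))).
    apply: cvg_app; apply: within_subset => u; rewrite /= in_itv /=.
    by move=> /andP[t0u ut]; apply: sT.
  - by rewrite ge_min le_max (ltW Yr) (ltW rY) orbT.
  rewrite in_itv /= => /andP[t0s st] /cS' cY.
  have := lyapunov_nonincreasing dH H0 solY (sT s t0s st).
  by rewrite leNgt (lt_le_trans YHc).
have Ty := compact_maximal_solution_global cptE cF (cptE Ys r) maxY stay.
split=> // t t0t; apply: (proj1 (rNO _ _)).
rewrite /closed_ball_/= distrC; apply: stay.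
by rewrite Ty /time_interval /= lee_fin (ltW t0t) ltry.
Qed.
End Lyapunov.
(** * Column vectors *)

Section ColumnVectors.
Variable R : realType.

Lemma mx_norm_leP (m n : nat) (B : 'M[R]_(m, n)) (c : R) : 0 <= c ->
  (`|B| <= c) <-> forall i j, `|B i j| <= c.
Proof.
move=> c0; rewrite /Num.Def.normr /= mx_normrE; split => [+ i j|H].
  by apply: le_trans; exact: (le_bigmax _ (fun ij => `|B ij.1 ij.2|) (i, j)).
by apply: bigmax_le => // ij _; exact: H.
Qed.

Lemma mx_continuousP (T : topologicalType) (m n : nat) (f : T -> 'M[R]_(m, n)) x :
  (forall i j, {for x, continuous (fun y => f y i j)}) -> {for x, continuous f}.
Proof.
move=> H; apply/cvgrPdist_le => e e0.
near=> y; apply/mx_norm_leP => [|i j]; first exact: ltW.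
rewrite !mxE; move: i j; near: y; apply: filter_forall => i.
apply: filter_forall => j; exact: ((cvgrPdist_le _ _).1 (H i j) e e0).
Unshelve. all: by end_near.
Qed.

Lemma mulmx_continuous (m n p : nat) (B : 'M[R]_(m, n)) :
  continuous (mulmx B : 'M[R]_(n, p) -> 'M[R]_(m, p)).
Proof.
move=> x; apply: mx_continuousP => i j.
rewrite (_ : (fun y => _) = fun y : 'M[R]_(n, p) => \sum_k B i k * y k j).
  apply: continuous_big => [|k _ y]; first exact: add_continuous.
  exact: (continuousM (cvg_cst _) (@coord_continuous R n p k j y)).
by apply/funext => y; rewrite mxE.
Qed.

Lemma trmx_continuous (m n : nat) : continuous (@trmx R m n).
Proof.
move=> x; apply: mx_continuousP => i j.
rewrite (_ : (fun y => _) = fun y : 'M[R]_(m, n) => y j i).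
  exact: coord_continuous.
by apply/funext => y; rewrite mxE.
Qed.

(** Closed bounded sets of row vectors are compact; transposition is continuous and preserves the
    entrywise maximum norm. *)
Lemma compact_closed_ball_col (n : nat) (z : 'cV[R]_n) (r : R) :
  compact [set u : 'cV[R]_n | `|u - z| <= r].
Proof.
have closedE (E : normedModType R) (w : E) : closed [set u : E | `|u - w| <= r].
  apply: (preimage_closed (f := fun u : E => `|u - w|) (D := [set c | c <= r])).
    by move=> u _; apply: cvg_norm; apply: cvgB => //; exact: cvg_cst.
  exact: closed_le.
have [r0|r0] := leP 0 r; last first.
  rewrite (_ : mkset _ = set0); first exact: compact0.
  by apply/seteqP; split => // u /= /(le_trans (normr_ge0 _)); rewrite leNgt r0.
rewrite (_ : mkset _ = trmx @` [set u : 'rV[R]_n | `|u - z^T| <= r]).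
  apply: continuous_compact; first exact/continuous_subspaceT/trmx_continuous.
  apply: bounded_closed_compact; last exact: closedE.
  exists (r + `|z^T|); split; first exact: num_real.
  move=> M rM u /= uz; rewrite -(subrK z^T u); apply: (le_trans (ler_normD _ _)).
  by apply/ltW/(le_lt_trans _ rM); rewrite lerD2r.
apply/seteqP; split => u /=.
  move=> /mx_norm_leP H; exists u^T; rewrite ?trmxK//.
  by apply/mx_norm_leP => // i j; have := H r0 j i; rewrite !mxE.
move=> [v /mx_norm_leP H <-].
by apply/mx_norm_leP => // i j; have := H r0 j i; rewrite !mxE.
Qed.

Lemma compact_closed_ball_pair (E1 E2 : normedModType R) :
  (forall (z : E1) r, compact [set u : E1 | `|u - z| <= r]) ->
  (forall (z : E2) r, compact [set u : E2 | `|u - z| <= r]) ->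
  forall (z : E1 * E2) r, compact [set u : E1 * E2 | `|u - z| <= r].
Proof.
move=> c1 c2 [z1 z2] r; have := compact_setX (c1 z1 r) (c2 z2 r).
congr compact; apply/seteqP; split => -[u1 u2] /=.
  by move=> [H1 H2]; rewrite prod_normE /= ge_max H1 H2.
by rewrite prod_normE /= ge_max => /andP.
Qed.

Lemma tr_mulmx_ge0 (m : nat) (u : 'cV[R]_m) : 0 <= (u^T *m u) 0 0.
Proof. by rewrite mxE sumr_ge0// => i _; rewrite mxE -expr2 sqr_ge0. Qed.

Lemma tr_mulmx_eq0 (m : nat) (u : 'cV[R]_m) : (u^T *m u) 0 0 = 0 -> u = 0.
Proof.
rewrite mxE => /eqP; rewrite psumr_eq0 => [|i _]; last first.
  by rewrite mxE -expr2 sqr_ge0.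
move=> /allP H; apply/colP => i; have := H i (mem_index_enum _).
by rewrite !mxE mulf_eq0 orbb => /eqP.
Qed.

(** If [v] kills the Gram matrix, then [A *m v^T] has zero Euclidean length, so it vanishes, and
    full column rank gives [v = 0]. *)
Lemma gram_unitmx (m n : nat) (A : 'M[R]_(m, n)) :
  \rank A = n -> A^T *m A \in unitmx.
Proof.
move=> rA; rewrite -row_free_unit; apply: inj_row_free => v.
rewrite mulmxA => /(congr1 (mulmx^~ v^T)); rewrite mul0mx => H.
have : A *m v^T = 0.
  by apply: tr_mulmx_eq0; rewrite trmx_mul trmxK mulmxA H mxE.
move=> /(congr1 trmx); rewrite trmx_mul trmxK trmx0.
have fA : row_free A^T by rewrite /row_free mxrank_tr rA.
by move=> /(congr1 (mulmx^~ (pinvmx A^T))); rewrite mulmxKp// mul0mx.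
Qed.

Lemma diff_gradient (n : nat) (V : 'cV[R]_n -> R) (x u : 'cV[R]_n) :
  differentiable V x -> 'd V x u = (u^T *m gradient V x) 0 0.
Proof.
move=> dV; rewrite {1}(matrix_sum_delta u) linear_sum mxE; apply: eq_bigr => i _.
by rewrite big_ord1 linearZ /= !mxE -deriveE// -[ord0]/0 (ord1 0).
Qed.

(** Fermat's rule in one variable, applied to [V] along each coordinate line through [x]. *)
Lemma gradient_local_minimizer (n : nat) (V : 'cV[R]_n -> R) (x : 'cV[R]_n) :
  (forall x, differentiable V x) -> strict_local_minimizer V x ->
  gradient V x = 0.
Proof.
move=> dV [U [oU Ux HU]]; apply/colP => i; rewrite !mxE.
set v := delta_mx i 0.
pose Y := ( *:%R ^~ v : R -> 'cV[R]_n) + cst x.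
have dY h : is_derive h (1 : R) Y v.
  have dYh : is_diff h Y _ := is_diffD (is_diff_scalel h v) (is_diff_cst x h).
  split; first by apply/derivable1_diffP; exact: ex_diff.
  by rewrite deriveE ?diff_val /= ?addr0 ?scale1r//; exact: ex_diff.
have Y0 : Y 0 = x by rewrite [LHS](_ : _ = 0 *: v + x)// scale0r add0r.
have dVY h := is_derive_diff_comp (dV (Y h)) (dY h).
have [r /= r0 Hr] : exists2 r : R, 0 < r & forall h, `|h| < r -> U (Y h).
  have cY : {for 0, continuous Y}.
    by apply/differentiable_continuous/derivable1_diffP; case: (dY 0).
  have /nbhs_ballP[r /= r0 Hr] : \forall h \near (0 : R), U (Y h).
    by apply: cY; rewrite Y0; exact: open_nbhs_nbhs.
  by exists r => // h hr; apply: Hr; rewrite /ball/= sub0r normrN.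
have : is_derive (0 : R) 1 (V \o Y) 0.
  apply: (@derive1_at_min _ _ (- r) r).
  - by rewrite ge0_cp// ltW.
  - by move=> h _; case: (dVY h).
  - by rewrite in_itv /= oppr_lt0 r0.
  - move=> h; rewrite in_itv /= -ltr_norml => /Hr Uh.
    have [-> //|hx] := eqVneq (Y h) x; first by rewrite /= Y0.
    by rewrite /= Y0; apply/ltW/HU.
by rewrite deriveE// -[in 'd V x]Y0; case: (dVY 0) => _ <- [_ ->].
Qed.

End ColumnVectors.
(** * The A-ADMM flow *)

Section AADMM.
Variables (R : realType) (m n : nat) (A : 'M[R]_(m, n)).

Lemma differentiable_composite_objective (f : 'cV[R]_n -> R)
    (g : 'cV[R]_m -> R) x :
  differentiable f x -> differentiable g (A *m x) ->
  differentiable (composite_objective f g A) x.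
Proof.
move=> df dg; apply: (@differentiableD _ _ _ f (g \o mulmx A)) => //.
apply: differentiable_comp => //; apply: linear_differentiable.
exact: mulmx_continuous.
Qed.

Lemma gradient_composite_objective (f : 'cV[R]_n -> R) (g : 'cV[R]_m -> R) x :
  differentiable f x -> differentiable g (A *m x) ->
  gradient (composite_objective f g A) x =
  gradient f x + A^T *m gradient g (A *m x).
Proof.
move=> df dg.
have dA : differentiable (mulmx A : 'cV[R]_n -> 'cV[R]_m) x.
  by apply: linear_differentiable; exact: mulmx_continuous.
have dAE : 'd (mulmx A : 'cV[R]_n -> 'cV[R]_m) x = mulmx A :> (_ -> _).
  by apply: diff_lin; exact: mulmx_continuous.
apply/colP => i; rewrite !mxE deriveE; last exact: differentiable_composite_objective.
rewrite (_ : composite_objective f g A = f + (g \o mulmx A))//.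
rewrite diffD//; last exact: differentiable_comp.
rewrite (diff_comp dA dg) /= dAE deriveE//; congr (_ + _).
rewrite diff_gradient// trmx_mul trmx_delta.
by rewrite -mulmxA -rowE mxE mxE.
Qed.

Lemma continuously_differentiable_composite_objective
    (f : 'cV[R]_n -> R) (g : 'cV[R]_m -> R) :
  continuously_differentiable f -> continuously_differentiable g ->
  continuously_differentiable (composite_objective f g A).
Proof.
move=> [df cf] [dg cg]; split.
  by move=> x; exact: differentiable_composite_objective.
rewrite (_ : gradient _ = fun x => gradient f x + A^T *m gradient g (A *m x)).
  move=> x; apply: (continuousD (cf x)).
  apply: (continuous_comp _ (@mulmx_continuous _ _ _ _ A^T _)).
  exact: continuous_comp (@mulmx_continuous _ _ _ _ A _) (cg _).
by apply/funext => x; rewrite gradient_composite_objective.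
Qed.

Lemma aadmm_field_continuous (r : R) (V : 'cV[R]_n -> R) z t :
  continuous (gradient V) -> t != 0 ->
  {for (z, t), continuous
    (fun p : ('cV[R]_n * 'cV[R]_n) * R => aadmm_field A r V p.1 p.2)}.
Proof.
move=> cV t0'.
set P := (('cV[R]_n * 'cV[R]_n) * R)%type.
have c2 : {for (z, t), continuous (fun p : P => p.1.2)}.
  by apply: (cvg_comp fst snd); [exact: cvg_fst|exact: cvg_snd].
have c1 : {for (z, t), continuous (fun p : P => p.1.1)}.
  by apply: (cvg_comp fst fst); [exact: cvg_fst|exact: cvg_fst].
have c3 : {for (z, t), continuous (fun p : P => - (r / p.2))}.
  have c4 : {for (z, t), continuous (fun p : P => p.2)} by exact: cvg_snd.
  apply: continuousN; apply: continuousM; first exact: cvg_cst.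
  exact: continuousV.
have c5 : {for (z, t), continuous
    (fun p : P => invmx (A^T *m A) *m gradient V p.1.1)}.
  apply: (continuous_comp _ (@mulmx_continuous _ _ _ _ _ _)).
  exact: (continuous_comp c1 (cV _)).
exact: (cvg_pair c2 (continuousB (continuousZ c3 c2) c5)).
Qed.

(** Kinetic plus potential energy. The kinetic term uses the metric [A^T *m A], chosen to cancel the
    inverse Gram matrix in the field. *)
Definition energy (V : 'cV[R]_n -> R) (z : 'cV[R]_n * 'cV[R]_n) : R :=
  2^-1 * ((A *m z.2)^T *m (A *m z.2)) 0 0 + V z.1.

(** The kinetic term is half a sum of squares of the continuous linear forms [q i], each of which is
    its own differential. *)
Lemma diff_energy (V : 'cV[R]_n -> R) (z w : 'cV[R]_n * 'cV[R]_n) :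
  differentiable V (z.1) ->
  differentiable (energy V) z /\
  'd (energy V) z w = ((A *m z.2)^T *m (A *m w.2)) 0 0 + 'd V (z.1) w.1.
Proof.
move=> dV.
pose q i (z : 'cV[R]_n * 'cV[R]_n) := (A *m z.2) i 0.
have lq i : linear (q i).
  by move=> k u v; rewrite /q /= mulmxDr -scalemxAr !mxE.
have cq i : continuous (q i).
  move=> u; apply: (cvg_comp snd (fun y => (A *m y) i 0)); first exact: cvg_snd.
  apply: (cvg_comp (mulmx A) (fun y : 'cV[R]_m => y i 0)).
    exact: mulmx_continuous.
  exact: coord_continuous.
have dq i : differentiable (q i) z /\ 'd (q i) z = q i :> (_ -> _).
  pose qM := GRing.isLinear.Build _ _ _ _ _ (lq i).
  pose qL : {linear _ -> _} := HB.pack (q i) qM.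
  have -> : q i = qL by [].
  by split; [apply: linear_differentiable|apply: diff_lin]; exact: cq.
have d1 : differentiable (fst : 'cV[R]_n * 'cV[R]_n -> 'cV[R]_n) z /\
    'd (fst : 'cV[R]_n * 'cV[R]_n -> 'cV[R]_n) z = fst :> (_ -> _).
  by split; [apply: linear_differentiable|apply: diff_lin]; move=> u; exact: cvg_fst.
have EE : energy V = 2^-1 *: (\sum_i (q i ^+ 2)) + (V \o fst).
  apply/funext => u; rewrite /energy mxE.
  rewrite [RHS](_ : _ = 2^-1 * (\sum_i q i ^+ 2) u + V u.1)// fct_sumE.
  by congr (_ * _ + _); apply: eq_bigr => i _; rewrite mxE /q /= -expr2.
have dVf : differentiable (V \o fst) z by apply: differentiable_comp => //; case: d1.
have dE : differentiable (energy V) z.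
  rewrite EE; apply: differentiableD => //; apply: differentiableZ.
  apply: differentiable_sum => i; apply: differentiableX; exact: (dq i).1.
split=> //; rewrite -deriveE//.
have : is_derive z w (energy V)
    (2^-1 *: (\sum_i (2%:R * q i z ^+ 1) *: q i w) + 'd V (z.1) w.1).
  rewrite EE; apply: is_deriveD; last first.
    split; first exact: diff_derivable.
    by rewrite deriveE// diff_comp//= ?(proj2 d1)//; case: d1.
  apply: is_deriveZ; apply: is_derive_sum => i; apply: is_deriveX.
  split; first exact/diff_derivable/(dq i).1.
  by rewrite deriveE ?(proj2 (dq i))//; exact: (dq i).1.
move=> [_ ->]; congr (_ + _); rewrite mxE [LHS]scaler_sumr; apply: eq_bigr => i _.
by rewrite expr1 /GRing.scale /= mulrA mulrA mulVf ?mul1r// mxE.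
Qed.

(** Once the Gram matrix cancels its inverse, the two terms pairing the velocity with the gradient
    of [V] cancel, and only the friction term remains. *)
Lemma diff_energy_field (V : 'cV[R]_n -> R) (z : 'cV[R]_n * 'cV[R]_n)
    (r t : R) :
  \rank A = n -> 0 <= r / t -> differentiable V (z.1) ->
  'd (energy V) z (aadmm_field A r V z t) <= 0.
Proof.
move=> rA rt dV; have [_ ->] := diff_energy (aadmm_field A r V z t) dV.
rewrite diff_gradient// trmx_mul -mulmxA (mulmxA A^T) /aadmm_field /= mulmxBr.
rewrite mulKVmx ?gram_unitmx// mulmxBr -!scalemxAr mxE [X in _ + X + _]mxE subrK.
rewrite mxE mulNr oppr_le0 mulr_ge0// -(mulmxA A^T) (mulmxA _ A^T) -trmx_mul.
exact: tr_mulmx_ge0.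
Qed.

Lemma energy_strict_local_minimizer (V : 'cV[R]_n -> R) (x : 'cV[R]_n) :
  \rank A = n -> strict_local_minimizer V x ->
  strict_local_minimizer (energy V) (x, 0).
Proof.
move=> rA [U [oU Ux HU]]; exists (fst @^-1` U); split => //.
  by apply: open_comp => // u _; exact: cvg_fst.
move=> [x' y] /= Ux' xy; rewrite /energy /= mulmx0 trmx0 mul0mx mxE mulr0 add0r.
have y0 : 0 <= 2^-1 * ((A *m y)^T *m (A *m y)) 0 0.
  by rewrite mulr_ge0// tr_mulmx_ge0.
have [x'x|x'x] := eqVneq x' x; last by rewrite ltr_wpDl// HU.
subst x'; rewrite ltrDr lt_neqAle y0 andbT eq_sym.
rewrite mulf_eq0 invr_eq0 pnatr_eq0 /=; apply/negP => /eqP Ay.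
move/negP : xy; apply; apply/eqP; congr pair.
(* Injectivity of [A] in explicit form: [y] is recovered from [A *m y] through the inverse Gram
   matrix. *)
rewrite -[y](mulKmx (gram_unitmx rA)) -mulmxA (tr_mulmx_eq0 Ay).
by rewrite !mulmx0.
Qed.

End AADMM.

(** * Equivalence of the first-order system with the second-order flow *)

Lemma has_derivative_within_pair (R : realType) (E1 E2 : normedModType R)
    (D : set R) (Y1 : R -> E1) (Y2 : R -> E2) (t : R) (d1 : E1) (d2 : E2) :
  has_derivative_within D (fun s => (Y1 s, Y2 s)) t (d1, d2) <->
  has_derivative_within D Y1 t d1 /\ has_derivative_within D Y2 t d2.
Proof.
split=> [/has_derivative_withinP H|].
  split; apply/has_derivative_withinP => e e0; have [del del0 Hd] := H e e0;
    exists del => // s Ds st; apply: le_trans (Hd s Ds st);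
    by rewrite [leRHS]prod_normE /= le_max lexx ?orbT.
move=> [/has_derivative_withinP H1 /has_derivative_withinP H2].
apply/has_derivative_withinP => e e0.
have [del1 del10 Hd1] := H1 e e0; have [del2 del20 Hd2] := H2 e e0.
exists (Num.min del1 del2); first by rewrite lt_min del10.
move=> s Ds; rewrite lt_min => /andP[st1 st2].
by rewrite [leLHS]prod_normE /= ge_max Hd1// Hd2.
Qed.

(** Each time in the interval has later times of the interval arbitrarily close to it, so the filter
    defining the derivative is proper and limits are unique. *)
Lemma has_derivative_within_unique (R : realType) (E : normedModType R)
    (t0 : R) (T : \bar R) (Y : R -> E) (t : R) (d1 d2 : E) :
  time_interval t0 T t ->
  has_derivative_within (time_interval t0 T) Y t d1 ->
  has_derivative_within (time_interval t0 T) Y t d2 -> d1 = d2.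
Proof.
move=> /andP[]; rewrite lee_fin => t0t tT H1 H2.
have [u tu uT] : exists2 u, t < u & (u%:E <= T)%E.
  case: T tT {H1 H2} => [T| |] //; first by rewrite lte_fin; exists T.
  by exists (t + 1); rewrite ?ltrDl ?leey.
suff PF : ProperFilter (within (time_interval t0 T) t^').
  exact: (norm_cvg_unique H1 H2).
apply: Build_ProperFilter_ex => P /nbhs_ballP[del /= del0 HP].
pose h := Num.min (del / 2) ((u - t) / 2).
have h0 : 0 < h by rewrite lt_min !divr_gt0// subr_gt0.
have hdel : h <= del / 2 by rewrite ge_min lexx.
have hu : h <= (u - t) / 2 by rewrite ge_min lexx orbT.
exists (t + h); apply: HP.
- rewrite /ball/= opprD addrA subrr sub0r normrN gtr0_norm//; lra.
- by rewrite -subr_eq0 addrAC subrr add0r gt_eqF.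
- rewrite /time_interval /= lee_fin; apply/andP; split; first lra.
  apply: lt_le_trans uT; rewrite lte_fin; lra.
Qed.

Lemma eq_has_derivative_within (R : realType) (E : normedModType R)
    (D : set R) (Y Y' : R -> E) (t : R) (d : E) :
  D t -> (forall s, D s -> Y s = Y' s) ->
  has_derivative_within D Y t d -> has_derivative_within D Y' t d.
Proof.
move=> Dt YY' /has_derivative_withinP H; apply/has_derivative_withinP => e e0.
have [del del0 Hd] := H e e0; exists del => // s Ds.
by rewrite -!YY'//; exact: Hd.
Qed.

(** The flow quantifies its velocity existentially. Requiring [dX] to be the derivative of [X] pins
    it down, and uniqueness of derivatives identifies it with the witness [Y1] on the interval. *)
Lemma is_solution_aadmm (R : realType) (m n : nat) (A : 'M[R]_(m, n))
    (r t0 : R) (V : 'cV[R]_n -> R) (T : \bar R) (X dX : R -> 'cV[R]_n) :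
  is_solution (aadmm_field A r V) t0 T (fun t => (X t, dX t)) <->
  aadmm_flow_solution A r V t0 T X /\
  (forall t, time_interval t0 T t ->
     has_derivative_within (time_interval t0 T) X t (dX t)).
Proof.
split=> [[t0T sol]|[[t0T [Y1 [Y2 HY]]] HX]].
  have H t tT := (has_derivative_within_pair _ _ _ _ _ _).1 (sol t tT).
  split=> [|t /H[]//]; split=> //.
  exists dX, (fun t => - (r / t) *: dX t - invmx (A^T *m A) *m gradient V (X t)).
  move=> t tT; have [H1 H2] := H t tT; split=> //.
  by rewrite scaleNr addrAC subrK addNr.
split=> // t tT; apply/has_derivative_within_pair; split; first exact: HX.
have YdX s : time_interval t0 T s -> Y1 s = dX s.
  move=> sT; have [H1 _ _] := HY s sT.
  exact: has_derivative_within_unique sT H1 (HX s sT).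
have [_ H2 Heq] := HY t tT.
rewrite /= (_ : _ - _ = Y2 t); first exact: eq_has_derivative_within tT YdX H2.
rewrite -YdX// scaleNr -opprD; apply/esym/eqP.
by rewrite -addr_eq0 addrA Heq.
Qed.

Theorem theorem8 (R : realType) (m n : nat) (f : 'cV[R]_n -> R)
    (g : 'cV[R]_m -> R) (A : 'M[R]_(m, n)) (r t0 : R) (Xs : 'cV[R]_n)
    (f_C1 : continuously_differentiable f)
    (g_C1 : continuously_differentiable g)
    (f_convex : convex_function [set: convex_lmodType 'cV[R]_n] f)
    (g_convex : convex_function [set: convex_lmodType 'cV[R]_m] g)
    (le_nm : (n <= m)%N) (A_rank : \rank A = n)
    (r_ge3 : 3 <= r) (t0_gt0 : 0 < t0)
    (Xs_min : strict_local_minimizer (composite_objective f g A) Xs) :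
  let V := composite_objective f g A in
  stable_critical_point (aadmm_field A r V) t0 (Xs, 0) /\
  (forall (T : \bar R) (X dX : R -> 'cV[R]_n),
     is_solution (aadmm_field A r V) t0 T (fun t => (X t, dX t)) <->
     aadmm_flow_solution A r V t0 T X /\
     (forall t, time_interval t0 T t ->
        has_derivative_within (time_interval t0 T) X t (dX t))).
Proof.
move=> V; split; last by move=> T X dX; exact: is_solution_aadmm.
have [dV cV] := continuously_differentiable_composite_objective A f_C1 g_C1.
have cptV := @compact_closed_ball_col R n.
(* Positive times make [r / t] both continuous, as Peano's theorem needs, and nonnegative, as the
   energy decrease needs. *)
have pos t : t0 <= t -> 0 < t by exact: lt_le_trans.
apply: (lyapunov_stability (H := energy A V)).
- exact: compact_closed_ball_pair.
- by move=> z t /pos t_gt0; apply: aadmm_field_continuous => //; rewrite gt_eqF.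
- move=> t _; rewrite /aadmm_field /= gradient_local_minimizer//.
  by rewrite scaler0 mulmx0 subrr.
- exact: energy_strict_local_minimizer.
- by move=> z; have [] := diff_energy A z (dV z.1).
- move=> z t /pos t_gt0; apply: diff_energy_field => //.
  by rewrite divr_ge0 ?(ltW t_gt0)// (le_trans _ r_ge3).
Qed.
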